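(* Let $j$ and $n$ be non-negative integers, and let $\{(s_k),(\sigma_k)\}$, $k=0,1,2,\ldots$, be a binomial-transform pair of the first kind. Then \[ \sum_{k=0}^n(-1)^{n-k}\binom nk\binom{n-k}{j}2^k s_k=\sum_{k=0}^n(-1)^{j-k}\binom nk\binom{n-k}{j}2^k\sigma_k. \]
   Context: Two sequences $(s_k)_{k\ge0}$ and $(\sigma_k)_{k\ge0}$ of complex numbers form a binomial-transform pair of the first kind if $\sigma_n=\sum_{k=0}^n(-1)^k\binom nk s_k$ for every non-negative integer $n$. $\binom ab=0$ for integers $0\le a<b$. *)

(* Defs.v *)
(* The complex numbers are modelled as R[i] for an arbitrary R : realType. *)
From HB Require Import structures.
From mathcomp Require Import all_boot all_order all_algebra.
From mathcomp Require Import reals complex.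

Set Implicit Arguments.
Unset Strict Implicit.
Unset Printing Implicit Defensive.

Import GRing.Theory.
Local Open Scope ring_scope.

Definition binomial_pair1 (R : realType) (s sigma : nat -> R[i]) : Prop :=
  forall n : nat,
    sigma n = \sum_(0 <= k < n.+1) (-1) ^+ k * 'C(n, k)%:R * s k.

(* Main.v *)
(* Since C(n, k) C(n - k, j) = C(n, j) C(n - j, k), both sides are C(n, j) times
   a sum weighted by the single binomial C(m, k), where m = n - j. For these,
     \sum_k C(m, k) x^k sigma_k = \sum_i C(m, i) (-x)^i (1 + x)^(m - i) s_i,
   and x = -2 is the value for which 1 + x is a sign. *)
Require Import Defs.
From HB Require Import structures.
From mathcomp Require Import all_boot all_order all_algebra.
From mathcomp Require Import reals complex.
From mathcomp Require Import zify ring.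

Set Implicit Arguments.
Unset Strict Implicit.
Unset Printing Implicit Defensive.

Import GRing.Theory.
Local Open Scope ring_scope.

(** Multiplied by [i! (k - i)! (m - k)!], both sides become [m!]. *)
Lemma mul_bin_bin (m k i : nat) : (i <= k <= m)%N ->
  ('C(m, k) * 'C(k, i) = 'C(m, i) * 'C(m - i, k - i))%N.
Proof.
case/andP=> le_ik le_km; have le_im := leq_trans le_ik le_km.
have fact_pos : (0 < i`! * (k - i)`! * (m - k)`!)%N by rewrite !muln_gt0 !fact_gt0.
apply/eqP; rewrite -(eqn_pmul2r fact_pos); apply/eqP.
transitivity m`!.
  by rewrite -(bin_fact le_km) -(bin_fact le_ik); lia.
have := bin_fact (leq_sub2r i le_km).
rewrite subnBA // subnK // => fact_mi.
by rewrite -(bin_fact le_im) -fact_mi; lia.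
Qed.

(** Reflecting [C(n, k)] to [C(n, n - k)] reduces this to [mul_bin_bin], and a second reflection
    restores [k]. For [j > n - k] both sides vanish. *)
Lemma mul_bin_binC (n k j : nat) : (k <= n)%N ->
  ('C(n, k) * 'C(n - k, j) = 'C(n, j) * 'C(n - j, k))%N.
Proof.
move=> le_kn; have [le_j|lt_j] := leqP j (n - k); last first.
  rewrite (bin_small lt_j) muln0; have [le_jn|lt_nj] := leqP j n.
    by rewrite (@bin_small (n - j)) ?muln0 //; lia.
  by rewrite (bin_small lt_nj).
rewrite -(bin_sub le_kn) mul_bin_bin ?le_j ?leq_subr //.
rewrite -(@bin_sub (n - j) k); last by lia.
by congr (_ * 'C(_, _))%N; lia.
Qed.

(** Terms with [k < i] vanish; in the others [mul_bin_bin] extracts [C(m, i)], and the shift of [k]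
    by [i] leaves the binomial expansion of [(1 + x) ^+ (m - i)]. *)
Lemma sum_bin_bin_exp (R : comNzRingType) (x : R) (m i : nat) : (i <= m)%N ->
  \sum_(0 <= k < m.+1) 'C(m, k)%:R * 'C(k, i)%:R * x ^+ k
  = 'C(m, i)%:R * x ^+ i * (1 + x) ^+ (m - i).
Proof.
move=> le_im; rewrite (@big_cat_nat _ _ _ i) //=; last exact: leqW.
rewrite big_nat_cond big1 ?add0r; last first.
  by move=> k /andP[/andP[_ lt_ki] _]; rewrite (bin_small lt_ki) mulr0 mul0r.
rewrite exprDn mulr_sumr -{1}(add0n i) big_addn subSn // big_mkord.
apply: eq_bigr => k _; have le_k : (k <= m - i)%N by rewrite -ltnS.
rewrite -natrM mul_bin_bin; last by lia.
by rewrite addnK expr1n mul1r natrM exprD -mulr_natr; ring.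
Qed.

Lemma sum_bin_exp_pair1 (R : realType) (s sigma : nat -> R[i]) (x : R[i]) (m : nat) :
  binomial_pair1 s sigma ->
  \sum_(0 <= k < m.+1) 'C(m, k)%:R * x ^+ k * sigma k
  = \sum_(0 <= i < m.+1) 'C(m, i)%:R * (- x) ^+ i * (1 + x) ^+ (m - i) * s i.
Proof.
move=> hs.
transitivity (\sum_(0 <= k < m.+1) \sum_(0 <= i < m.+1)
    ((-1) ^+ i * s i) * ('C(m, k)%:R * 'C(k, i)%:R * x ^+ k)).
  apply: eq_big_nat => k /andP[_ lt_km].
  (* The inner range can be extended from [i <= k] to [i <= m] because [C(k, i) = 0] beyond [k]; the
     two sums then have independent ranges and can be exchanged. *)
  rewrite hs mulr_sumr [RHS](@big_cat_nat _ _ _ k.+1) //=.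
  rewrite [X in _ + X]big_nat_cond [X in _ + X]big1 ?addr0; last first.
    by move=> i /andP[/andP[lt_ki _] _]; rewrite (bin_small lt_ki); ring.
  by apply: eq_bigr => i _; ring.
rewrite exchange_big_nat /=; apply: eq_big_nat => i /andP[_ lt_im].
by rewrite -mulr_sumr sum_bin_bin_exp // [(- x) ^+ i]exprNn; ring.
Qed.

Lemma sum_bin_bin (R : comNzRingType) (n j : nat) (F : nat -> R) : (j <= n)%N ->
  \sum_(0 <= k < n.+1) 'C(n, k)%:R * 'C(n - k, j)%:R * F k
  = 'C(n, j)%:R * \sum_(0 <= k < (n - j).+1) 'C(n - j, k)%:R * F k.
Proof.
move=> le_jn; rewrite mulr_sumr (@big_cat_nat _ _ _ (n - j).+1) //=; last first.
  by rewrite ltnS leq_subr.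
rewrite [X in _ + X]big_nat_cond [X in _ + X]big1 ?addr0; last first.
  move=> k /andP[/andP[lt_k lt_kn] _].
  by rewrite (@bin_small (n - k)) ?mulr0 ?mul0r //; lia.
apply: eq_big_nat => k /andP[_ lt_k].
by rewrite mulrA -!natrM mul_bin_binC //; lia.
Qed.

(* On the right the exponent j - k may be negative, so it is taken in int. *)
Theorem theorem24 (R : realType) (j n : nat) (s sigma : nat -> R[i])
    (hs : binomial_pair1 s sigma) :
  \sum_(0 <= k < n.+1)
      (-1) ^+ (n - k)%N * 'C(n, k)%:R * 'C(n - k, j)%:R * 2 ^+ k * s k
  = \sum_(0 <= k < n.+1)
      (-1) ^ (j%:Z - k%:Z) * 'C(n, k)%:R * 'C(n - k, j)%:R * 2 ^+ k * sigma k.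
Proof.
have [le_jn|lt_nj] := leqP j n; last first.
  by rewrite !big1 // => k _; rewrite (@bin_small (n - k)) ?mulr0 ?mul0r //; lia.
transitivity (\sum_(0 <= k < n.+1) 'C(n, k)%:R * 'C(n - k, j)%:R *
    ((-1) ^+ (n - k) * 2 ^+ k * s k)).
  by apply: eq_bigr => k _; ring.
transitivity (\sum_(0 <= k < n.+1) 'C(n, k)%:R * 'C(n - k, j)%:R *
    ((-1) ^+ j * (- 2) ^+ k * sigma k)); last first.
  (* As [-1] is its own inverse, [(-1) ^ (- k)] is [(-1) ^+ k], which turns [2 ^+ k] into
     [(- 2) ^+ k]. *)
  apply: eq_bigr => k _; rewrite expfzDr ?oppr_eq0 ?oner_eq0 //.
  by rewrite -exprnP -exprnN invr_sign [(- 2) ^+ k]exprNn; ring.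
rewrite !sum_bin_bin //; congr (_ * _).
transitivity ((-1) ^+ j * \sum_(0 <= k < (n - j).+1)
    'C(n - j, k)%:R * (- 2) ^+ k * sigma k); last first.
  by rewrite mulr_sumr; apply: eq_bigr => k _; ring.
rewrite (sum_bin_exp_pair1 _ _ hs) mulr_sumr.
apply: eq_big_nat => k /andP[_ lt_k].
(* The factor [(-1) ^+ j] splits off, and the remaining sign is [(1 + x) ^+ (n - j - k)] at
   [x = -2]. *)
have -> : (n - k = j + (n - j - k))%N by lia.
have -> : 1 + (- 2) = -1 :> R[i] by ring.
by rewrite opprK exprD; ring.
Qed.
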